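(* Let $k\ge 0$ be an integer and let $I\subseteq R=\mathbb{K}[x_1,\dots,x_n]$ be a $k$-decomposable monomial ideal with shedding monomial $u$, meaning that $u$ is a shedding monomial for $I$ with $|\mathrm{supp}(u)|\le k+1$ such that $I_u$ and $I^u$ are $k$-decomposable. Put $m=|\mathrm{supp}(u)|$. Then (i) $\mathrm{pd}(I)=\max\{\mathrm{pd}(I^u),\ \mathrm{pd}(I_u)+m\}$, and (ii) $\mathrm{reg}(I)=\max\{\mathrm{reg}(I^u),\ \mathrm{reg}(I_u)\}$.
   Context: $\mathbb{K}$ is a field and $R=\mathbb{K}[x_1,\dots,x_n]$ is standard graded. For a finitely generated graded $R$-module $M$ with graded Betti numbers $\beta_{i,j}(M)=\dim_{\mathbb{K}}\mathrm{Tor}_i^R(M,\mathbb{K})_j$, $\mathrm{pd}(M)=\max\{i:\beta_{i,j}(M)\ne 0\text{ for some } j\}$ is the projective dimension and $\mathrm{reg}(M)=\max\{j-i:\beta_{i,j}(M)\neq 0\}$ is the Castelnuovo–Mumford regularity. For a monomial ideal $I$, $\mathcal{G}(I)$ is its unique set of minimal monomial generators. For a monomial $u=x_1^{a_1}\cdots x_n^{a_n}$, $\mathrm{supp}(u)=\{x_i: a_i\neq 0\}$. For a monomial $M$, write $[u,M]=1$ if $x_i^{a_i}\nmid M$ for all $x_i\in\mathrm{supp}(u)$; otherwise write $[u,M]\ne 1$. For a monomial ideal $I$ define $$I^u=(M\in\mathcal{G}(I): [u,M]\neq 1),\qquad I_u=(M\in\mathcal{G}(I): [u,M]=1).$$ A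 monomial $u$ is a shedding monomial for $I$ if $I_u\ne 0$ and for each $M_i\in\mathcal{G}(I_u)$ and each $x_\ell\in\mathrm{supp}(u)$ there exists $M_j\in\mathcal{G}(I^u)$ such that $M_j:M_i=x_\ell$, where $M_j:M_i=M_j/\gcd(M_j,M_i)$ is the monomial generating the colon ideal $(M_j):(M_i)$. A monomial ideal $I$ with $\mathcal{G}(I)=\{M_1,\dots,M_r\}$ is called $k$-decomposable (recursive definition) if $r=1$, or else $I$ has a shedding monomial $u$ with $|\mathrm{supp}(u)|\le k+1$ such that the ideals $I_u$ and $I^u$ are $k$-decomposable. *)

(* Defs.v *)
From HB Require Import structures.
From mathcomp Require Import all_boot all_order all_algebra.
From mathcomp Require Import mpoly.
From Stdlib Require Import ClassicalEpsilon.

Set Implicit Arguments.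
Unset Strict Implicit.
Unset Printing Implicit Defensive.

Import Order.TTheory GRing.Theory Num.Theory.
Local Open Scope ring_scope.

(* An exponent vector m : 'X_{1..n} stands for the monomial x^m, so that
   divisibility of monomials is (m1 <= m2)%MM.  Ideals of {mpoly K[n]} are
   Prop-valued predicates. *)

Section Monomials.
Context {n : nat}.
Implicit Types (u m : 'X_{1..n}).

Definition msuppset u : {set 'I_n} := [set i | u i != 0%N].

Definition mgcd m1 m2 : 'X_{1..n} := [multinom minn (m1 i) (m2 i) | i < n].

(* The generator of the colon ideal (x^m1) : (x^m2). *)
Definition mcolon m1 m2 : 'X_{1..n} := (m1 - mgcd m1 m2)%MM.

(* The condition written [u, M] = 1. *)
Definition bracket1 u m : bool :=
  [forall i in msuppset u, ~~ ((U_(i) *+ u i)%MM <= m)%MM].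

End Monomials.

Section MonomialIdeals.
Context {K : fieldType} {n : nat}.
Implicit Types (I : {mpoly K[n]} -> Prop) (S : 'X_{1..n} -> Prop).
Implicit Types (u m : 'X_{1..n}).

Definition mideal S : {mpoly K[n]} -> Prop := fun p =>
  exists (s : seq 'X_{1..n}) (c : 'X_{1..n} -> {mpoly K[n]}),
    (forall m, m \in s -> S m) /\ p = \sum_(m <- s) c m * 'X_[m].

Definition monomial_ideal I : Prop :=
  exists S, forall p, I p <-> mideal S p.

(* G(I): the monomials of I that are minimal for divisibility. *)
Definition mingens I : 'X_{1..n} -> Prop := fun m =>
  I 'X_[m] /\ forall m', I 'X_[m'] -> (m' <= m)%MM -> m' = m.

(* I^u *)
Definition ideal_sup I u : {mpoly K[n]} -> Prop :=
  mideal (fun m => mingens I m /\ ~~ bracket1 u m).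

(* I_u *)
Definition ideal_sub I u : {mpoly K[n]} -> Prop :=
  mideal (fun m => mingens I m /\ bracket1 u m).

Definition shedding I u : Prop :=
  (exists2 p, ideal_sub I u p & p != 0) /\
  forall mi l, mingens (ideal_sub I u) mi -> l \in msuppset u ->
    exists2 mj, mingens (ideal_sup I u) mj & mcolon mj mi = U_(l)%MM.

Inductive kdecomposable (k : nat) : ({mpoly K[n]} -> Prop) -> Prop :=
| kdecomposable_one I :
    monomial_ideal I -> (exists m, forall m', mingens I m' <-> m' = m) ->
    kdecomposable k I
| kdecomposable_shed I u :
    monomial_ideal I -> shedding I u -> (#|msuppset u| <= k + 1)%N ->
    kdecomposable k (ideal_sub I u) -> kdecomposable k (ideal_sup I u) ->
    kdecomposable k I.

End MonomialIdeals.

Section Betti.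
Context {K : fieldType} {n : nat}.

(* A graded free resolution  ... -> F_1 -> F_0 -> I -> 0  by finitely generated
   graded free modules F_i = \bigoplus_a R(- fshift i a).  Elements of F_i are row
   vectors and maps are right multiplications by matrices.  A matrix entry
   between generators of degrees d and e is homogeneous of degree d - e (so it is
   zero when d < e); such a matrix is a graded map of degree 0. *)
Record gfree_resolution (I : {mpoly K[n]} -> Prop) := GFreeResolution {
  frank : nat -> nat;
  fshift : forall i, 'I_(frank i) -> int;
  augm : 'cV[{mpoly K[n]}]_(frank 0);
  fdiff : forall i, 'M[{mpoly K[n]}]_(frank i.+1, frank i);
  augm_homog : forall a m, m \in msupp (augm a 0) ->
    fshift a = (mdeg m)%:Z;
  fdiff_homog : forall i a b m, m \in msupp (fdiff i a b) ->
    fshift a = fshift b + (mdeg m)%:Z;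
  augm_image : forall p, I p <-> exists v : 'rV_(frank 0), v *m augm = p%:M;
  augm_exact : forall v : 'rV_(frank 0),
    v *m augm = 0 <-> exists w : 'rV_(frank 1), v = w *m fdiff 0;
  fdiff_exact : forall i (v : 'rV_(frank i.+1)),
    v *m fdiff i = 0 <-> exists w : 'rV_(frank i.+2), v = w *m fdiff i.+1
}.

Section Tor.
Context {I : {mpoly K[n]} -> Prop} (F : gfree_resolution I).

(* The differential F_(i+1) \otimes K -> F_i \otimes K, where K = R/(x_1,..,x_n):
   its matrix consists of the constant coefficients. *)
Definition tensor_diff i : 'M[K]_(frank F i.+1, frank F i) :=
  map_mx (mcoeff 0%MM) (fdiff F i).

(* Row space: the component of degree j of F_i \otimes K, spanned by the
   generators of degree j. *)
Definition tensor_piece i (j : int) : 'M[K]_(frank F i) :=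
  diag_mx (\row_a (fshift a == j)%:R).

Definition tor_cycles i (j : int) : 'M[K]_(frank F i) :=
  match i return 'M[K]_(frank F i) with
  | 0 => tensor_piece 0 j
  | i'.+1 => (tensor_piece i'.+1 j :&: kermx (tensor_diff i'))%MS
  end.

Definition tor_boundaries i (j : int) : 'M[K]_(frank F i.+1, frank F i) :=
  tensor_piece i.+1 j *m tensor_diff i.

(* dim_K H_i(F \otimes K)_j; the boundaries are contained in the cycles. *)
Definition tor_dim i (j : int) : nat :=
  (\rank (tor_cycles i j) - \rank (tor_boundaries i j))%N.

End Tor.

(* dim_K Tor_i(I, K)_j, computed from some graded free resolution. *)
Definition betti (I : {mpoly K[n]} -> Prop) (i : nat) (j : int) : nat :=
  epsilon (inhabits 0%N)
    (fun b => exists F : gfree_resolution I, b = tor_dim F i j).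

(* The greatest element of S, meaningful only when S has one. *)
Definition greatest {d} {T : orderType d} (x0 : T) (S : T -> Prop) : T :=
  epsilon (inhabits x0) (fun x => S x /\ forall y, S y -> (y <= x)%O).

Definition pd (I : {mpoly K[n]} -> Prop) : nat :=
  greatest 0%N (fun i => exists j, betti I i j <> 0%N).

Definition reg (I : {mpoly K[n]} -> Prop) : int :=
  greatest (0 : int) (fun r => exists i j, betti I i j <> 0%N /\ r = j - i%:Z).

End Betti.

(* Main.v *)
Require Import Defs.
From mathcomp Require Import all_boot all_order all_algebra.
From mathcomp Require Import mpoly zify.

(** An ideal has linear quotients when its minimal generators can be ordered
    in such a way that, for each generator m, the colon of the ideal of the
    earlier generators by m is generated by a set s(m) of variables.  The
    graded Betti numbers of such an ideal are

      beta_(i,j)(I) = sum of binomial(|s(m)|, i) over the m with deg m + i = j,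

    so that pd(I) is the largest |s(m)| and reg(I) is the largest degree of a
    generator ([betti_linear_quotients], [pd_linear_quotients],
    [reg_linear_quotients]).

    Every k-decomposable ideal has linear quotients.  If u is a shedding
    monomial of I, then G(I) is the disjoint union of G(I^u) and G(I_u), and it
    suffices to list the generators of I^u first and those of I_u next.  For a
    generator m of I_u the set s(m) then grows by exactly supp(u): the shedding
    condition provides every variable of supp(u), and an earlier generator
    coming from I^u is divisible by some x_l^(u_l), which does not divide m.
    The growth is by |supp(u)| new variables because the shedding condition
    forces every generator of I_u to have exponent u_l - 1 in each x_l of
    supp(u), so that no colon between two of them involves these variables
    ([shedding_exponent], [shedding_linear_quotients]).  Comparing the maxima
    over G(I), G(I^u) and G(I_u) gives both formulas.

    The Betti numbers are read off a minimal resolution, built by adding the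
    generators one at a time.  If m comes last, the Koszul complex on s(m)
    resolves the quotient by the colon ideal, and the mapping cone of a lift of
    multiplication by m resolves the enlarged ideal ([mapping_cone]).  The cone
    is minimal if that lift has no constant entry; this holds for degree reasons
    as soon as no earlier generator has a degree larger than that of m, and
    linear quotients can always be reordered by increasing degree without
    changing any s(m) ([linear_quotients_sort]).  Without the linear quotients
    of I^u the formula for pd can fail: the connecting maps from the Tor of I/I^u
    to that of I^u need not vanish.

    Since the Betti numbers are those of an unspecified resolution, the minimal
    resolution determines them only through the classical comparison theorem and
    the uniqueness of lifts up to homotopy ([comparison], [homotopy],
    [bettiE]). *)

Set Implicit Arguments.
Unset Strict Implicit.
Unset Printing Implicit Defensive.

Import Order.TTheory GRing.Theory Num.Theory.

(** * Monomial ideals *)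

Lemma functional_choice (T U : Type) (P : T -> U -> Prop) :
  (forall x, exists y, P x y) -> exists f, forall x, P x (f x).
Proof.
move=> H; exists (fun x => sval (ClassicalEpsilon.constructive_indefinite_description _ (H x))).
by move=> x; case: ClassicalEpsilon.constructive_indefinite_description.
Qed.

Section MonomialIdealTheory.
Context {K : fieldType} {n : nat}.
Local Open Scope ring_scope.
Implicit Types (S T : 'X_{1..n} -> Prop) (I : {mpoly K[n]} -> Prop).
Implicit Types (u m : 'X_{1..n}) (p q : {mpoly K[n]}).
#[local] Hint Resolve lepm_refl : core.

Lemma mcolonE m1 m2 i : mcolon m1 m2 i = (m1 i - m2 i)%N.
Proof. by rewrite mnmBE mnmE; lia. Qed.

Lemma mcolon_le m1 m2 m : (mcolon m1 m2 <= m)%MM = (m1 <= m2 + m)%MM.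
Proof.
by apply/mnm_lepP/mnm_lepP=> le i; move: (le i); rewrite mcolonE mnmDE; lia.
Qed.

Lemma mcolon_U m1 m2 l : mcolon m1 m2 = U_(l)%MM ->
  m1 l = (m2 l).+1 /\ forall i, i != l -> (m1 i <= m2 i)%N.
Proof.
move=> /mnmP e; split=> [|i il]; move: (e l); rewrite mcolonE mnm1E.
  by rewrite eqxx; lia.
by move: (e i); rewrite mcolonE mnm1E eq_sym (negbTE il); lia.
Qed.

Lemma bracket1P u m :
  reflect (forall i, u i != 0%N -> (m i < u i)%N) (bracket1 u m).
Proof.
have leE i : ((U_(i) *+ u i)%MM <= m)%MM = (u i <= m i)%N.
  apply/mnm_lepP/idP=> [/(_ i)|le j]; rewrite mulmnE mnm1E.
    by rewrite eqxx mul1n.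
  by case: eqVneq=> [<-|]; rewrite ?mul1n ?mul0n.
apply: (iffP forall_inP) => H i; last rewrite inE leE -ltnNge; last exact: H.
by move=> ui; move: (H i); rewrite inE leE -ltnNge; apply.
Qed.

Lemma mnm_le_mdeg m1 m2 : (m1 <= m2)%MM -> (mdeg m1 <= mdeg m2)%N.
Proof. by move=> /mnm_lepP le; rewrite !mdegE leq_sum. Qed.

Lemma mnm_le_mdeg_eq m1 m2 :
  (m1 <= m2)%MM -> (mdeg m2 <= mdeg m1)%N -> m1 = m2.
Proof.
move=> le; rewrite -{1}(submK le) mdegD => h.
by rewrite -[RHS](submK le) (_ : (m2 - m1)%MM = 0%MM) ?add0m //; apply/eqP;
  rewrite -mdeg_eq0; lia.
Qed.

Lemma mem_msuppMX p m m' :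
  (m' \in msupp (p * 'X_[m])) = (m <= m')%MM && ((m' - m)%MM \in msupp p).
Proof.
rewrite (perm_mem (msuppMX p m)); apply/mapP/andP=> [[m0 hm0 ->]|[le h]].
  by rewrite lem_addr addmC addmK.
by exists (m' - m)%MM => //; rewrite addmC submK.
Qed.

(** Membership in a monomial ideal is decided on the support, one monomial at a
    time; all later statements about ideals go through this criterion. *)
Lemma midealP S p :
  mideal S p <-> (forall m, m \in msupp p -> exists2 m0, S m0 & (m0 <= m)%MM).
Proof.
split=> [[s [c [Ss ->]]] m|H].
  move=> /msupp_sum_le /flatten_mapP [m0]; rewrite filter_predT => m0s.
  by rewrite mem_msuppMX => /andP[le _]; exists m0; first exact: Ss.
have [f fP] : exists f, forall m, m \in msupp p -> S (f m) /\ (f m <= m)%MM.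
  apply: (@functional_choice _ _ (fun m m0 => m \in msupp p -> S m0 /\ (m0 <= m)%MM)).
  move=> m; case: (boolP (m \in msupp p)) => [/H[m0]|_]; last by exists m.
  by exists m0.
exists (undup (map f (msupp p))).
exists (fun m0 => \sum_(m <- msupp p | f m == m0) p@_m *: 'X_[m - m0]); split.
  by move=> m0; rewrite mem_undup => /mapP[m /fP[Sm _] ->].
under eq_bigr do rewrite big_distrl /=.
rewrite (exchange_big_dep xpredT) //= {1}[p]mpolyE big_seq [RHS]big_seq.
apply: eq_bigr => m mp; have [_ le] := fP m mp.
under eq_bigl do rewrite eq_sym.
rewrite -big_filter filter_pred1_uniq ?undup_uniq ?mem_undup ?map_f // big_seq1.
by rewrite -scalerAl -mpolyXD submK.
Qed.
Lemma mideal_X S m : mideal (K := K) S 'X_[m] <-> exists2 m0, S m0 & (m0 <= m)%MM.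
Proof.
rewrite midealP; split=> [/(_ m)|H m']; rewrite msuppX inE; last by move/eqP->.
by rewrite eqxx; apply.
Qed.

Lemma mideal_colon S m p :
  mideal S (p * 'X_[m]) <-> mideal (fun m' => exists2 m0, S m0 & m' = mcolon m0 m) p.
Proof.
rewrite !midealP; split=> H m' m'p.
  have [|m0 Sm0 le] := H (m' + m)%MM; first by rewrite mem_msuppMX lem_addl addmK.
  by exists (mcolon m0 m); [exists m0 | rewrite mcolon_le addmC].
move: m'p; rewrite mem_msuppMX => /andP[le /H[_ [m0 Sm0 ->]]].
by rewrite mcolon_le addmC submK // => le0; exists m0.
Qed.

Lemma mideal_adjoin S m p :
  mideal (fun m' => m' = m \/ S m') p <-> exists q c, mideal S q /\ p = q + c * 'X_[m].
Proof.
split=> [/midealP H|[q [c [/midealP H ->]]]]; last first.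
  apply/midealP=> m' /msuppD_le; rewrite mem_cat => /orP[/H[m0 ? ?]|].
    by exists m0; first right.
  by rewrite mem_msuppMX => /andP[le _]; exists m; first left.
exists (\sum_(m' <- msupp p | ~~ (m <= m')%MM) p@_m' *: 'X_[m']).
exists (\sum_(m' <- msupp p | (m <= m')%MM) p@_m' *: 'X_[m' - m]); split; last first.
  rewrite {1}[p]mpolyE (bigID (fun m' => m <= m')%MM) /= addrC; congr (_ + _).
  rewrite big_distrl /=; apply: eq_bigr => m' le.
  by rewrite -scalerAl -mpolyXD submK.
apply/midealP=> m' /msupp_sum_le /flatten_mapP [m0].
rewrite mem_filter => /andP[nle m0p] /msuppZ_le; rewrite msuppX inE => /eqP->.
by have [m1 [e|]] := H _ m0p; [rewrite e (negbTE nle) | exists m1].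
Qed.

(** Descent on the degree; this replaces a noetherianity argument. *)
Lemma mingens_divides I m :
  I 'X_[m] -> exists2 m0, mingens I m0 & (m0 <= m)%MM.
Proof.
have [N] := ubnP (mdeg m); elim: N m => // N IH m ltN Im.
case: (Classical_Prop.classic (mingens I m)) => [?|nmin]; first by exists m;
  last exact: lepm_refl.
have [m' [Im' le ne]] : exists m', [/\ I 'X_[m'], (m' <= m)%MM & m' <> m].
  apply: Classical_Prop.NNPP => H; apply: nmin; split=> // m' Im' le.
  by apply: Classical_Prop.NNPP => ne; apply: H; exists m'.
have [|m0 m0min m0le] := IH m' _ Im'; last by exists m0; last exact: lepm_trans le.
apply: leq_trans (ltN : (mdeg m <= N)%N); rewrite ltnNge; apply/negP => ge.
by apply: ne; apply: mnm_le_mdeg_eq.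
Qed.

Lemma monomial_ideal_mingens I : monomial_ideal I ->
  forall p, I p <-> mideal (mingens I) p.
Proof.
move=> [S IS] p; rewrite IS !midealP; split=> H m /H [m0 Sm0 le].
  have [|m1 m1min le1] := @mingens_divides I m0.
    by apply/IS/mideal_X; exists m0.
  by exists m1; last exact: lepm_trans le.
have /IS/mideal_X[m1 ? le1] := proj1 Sm0.
by exists m1; last exact: lepm_trans le.
Qed.

(** In particular the generators of I^u and I_u, being taken from an antichain,
    stay minimal, so that G(I) is the disjoint union of G(I^u) and G(I_u). *)
Lemma mingens_mideal S :
  (forall m m', S m -> S m' -> (m <= m')%MM -> m = m') ->
  forall m, mingens (mideal (K := K) S) m <-> S m.
Proof.
move=> anti m; split=> [[/mideal_X[m0 Sm0 le] minm]|Sm].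
  by rewrite -(minm m0) //; apply/mideal_X; exists m0.
split=> [|m' /mideal_X[m0 Sm0 le] le']; first by apply/mideal_X; exists m.
have e := anti m0 m Sm0 Sm (lepm_trans le le'); rewrite e in le.
by apply: mnm_le_mdeg_eq le' (mnm_le_mdeg le).
Qed.

Lemma mingens_antichain I m m' :
  mingens I m -> mingens I m' -> (m <= m')%MM -> m = m'.
Proof. by move=> [Im _] [_]; apply. Qed.

Lemma mingens_sub I u m :
  mingens (ideal_sub I u) m <-> mingens I m /\ bracket1 u m.
Proof. by apply: mingens_mideal => m1 m2 [g1 _] [g2 _];
  apply: mingens_antichain g1 g2. Qed.

Lemma mingens_sup I u m :
  mingens (ideal_sup I u) m <-> mingens I m /\ ~~ bracket1 u m.
Proof. by apply: mingens_mideal => m1 m2 [g1 _] [g2 _];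
  apply: mingens_antichain g1 g2. Qed.

End MonomialIdealTheory.

(** * Linear quotients *)

Section LinearQuotients.
Context {n : nat}.
Implicit Types (A : seq 'X_{1..n}) (r : 'X_{1..n} -> nat) (m : 'X_{1..n}).
Implicit Types (s : 'X_{1..n} -> {set 'I_n}).

(** The order of the generators is given by the rank r rather than by the list
    A, so that reordering them only changes r.  Together, the last two fields
    say that the colon ideal of the earlier generators by m is generated by the
    variables of s m. *)
Record linear_quotients A r s : Prop := LinearQuotients {
  lq_uniq : uniq A;
  lq_antichain : {in A &, forall m m', (m <= m')%MM -> m = m'};
  lq_inj : {in A &, injective r};
  lq_variable : forall m l, m \in A -> l \in s m ->
    exists m', [/\ m' \in A, r m' < r m & mcolon m' m = U_(l)%MM];
  lq_linear : forall m m', m \in A -> m' \in A -> r m' < r m ->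
    exists2 l, l \in s m & m l < m' l
}.

(** Otherwise m' would have degree deg m + 1 and divide x_l m, hence be a multiple
    of m. *)
Lemma mcolon_variable_mdeg A m m' l : {in A &, forall m m', (m <= m')%MM -> m = m'} ->
  m \in A -> m' \in A -> mcolon m' m = U_(l)%MM -> mdeg m' <= mdeg m.
Proof.
move=> anti mA m'A e; rewrite leqNgt; apply/negP=> lt.
have le : (m' <= m + U_(l))%MM by rewrite -mcolon_le e lepm_refl.
have : m' = (m + U_(l))%MM by apply: mnm_le_mdeg_eq le _; rewrite mdegD mdeg1 addn1.
move=> em'; have /(anti _ _ mA m'A) emm : (m <= m')%MM by rewrite em' lem_addr.
by rewrite emm ltnn in lt.
Qed.

(** Among generators of the same degree the old order is kept.  The variables of
    s m are still provided, since they come from generators of degree at most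
    deg m.  Conversely, let m' have smaller degree than m but come later in the
    old order: linear quotients at m' replace it by an earlier m1, again of
    smaller degree, such that m1 divides x_l m' with x_l dividing m : m'.  Then
    the colon of m1 by m divides that of m' by m, and one descends until the
    generator precedes m in the old order. *)
Lemma linear_quotients_sort A r s : linear_quotients A r s ->
  exists2 r', linear_quotients A r' s &
    {in A &, forall m m', r' m' < r' m -> mdeg m' <= mdeg m}.
Proof.
move=> [uA anti inj var lin]; pose N := (\max_(m <- A) r m).+1.
have ltN m : m \in A -> r m < N by move=> mA; rewrite ltnS leq_bigmax_seq.
(* N exceeds every rank, so that r' compares degrees first, then old ranks. *)
pose r' m := (mdeg m * N + r m)%N.
have r'lt m m' : m \in A -> m' \in A ->
    (r' m' < r' m) = (mdeg m' < mdeg m) || (mdeg m' == mdeg m) && (r m' < r m).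
  move=> /ltN h /ltN h'; rewrite /r'.
  case: (ltngtP (mdeg m') (mdeg m)) => [lt|gt|->] /=.
  - have := leq_mul2r N (mdeg m').+1 (mdeg m); rewrite lt orbT mulSn; lia.
  - have := leq_mul2r N (mdeg m).+1 (mdeg m'); rewrite gt orbT mulSn; lia.
  - by rewrite ltn_add2l.
exists r'; last first.
  by move=> m m' mA m'A; rewrite r'lt // => /orP[/ltnW|/andP[/eqP->]].
split=> // [m m' mA m'A e|m l mA ls|m m' mA m'A].
- have h := r'lt m m' mA m'A; have h' := r'lt m' m m'A mA.
  rewrite e ltnn in h h'; apply: inj => //; lia.
- have [m' [m'A lt e]] := var m l mA ls; exists m'; split=> //.
  rewrite r'lt //; have := mcolon_variable_mdeg anti mA m'A e.
  by rewrite leq_eqVlt lt andbT orbC.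
rewrite r'lt // => h.
have [lt|ge] := ltnP (r m') (r m); first exact: lin.
have {h}degm' : mdeg m' < mdeg m by case/orP: h => // /andP[_]; lia.
have [k] := ubnP (r m'); elim: k m' m'A degm' ge => // k IH m' m'A degm' ge ltk.
have ltr : r m < r m'.
  by rewrite ltn_neqAle ge andbT; apply: contraTneq degm' => /inj-> //; rewrite ltnn.
have [x xs' mx] := lin m' m m'A mA ltr.
have [m1 [m1A ltr1 e1]] := var m' x m'A xs'.
have [e1x e1le] := mcolon_U e1.
have reduce l : m l < m1 l -> m l < m' l.
  by case: (eqVneq l x) => [->|/e1le]; lia.
have deg1 : mdeg m1 < mdeg m.
  by apply: leq_ltn_trans degm'; apply: mcolon_variable_mdeg anti _ m1A e1.
have [lt1|ge1] := ltnP (r m1) (r m).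
  by have [l ? /reduce ?] := lin m m1 mA m1A lt1; exists l.
by have [|l ? /reduce ?] := IH m1 m1A deg1 ge1; [lia | exists l].
Qed.

End LinearQuotients.

Section Shedding.
Context {K : fieldType} {n : nat}.
Implicit Types (I : {mpoly K[n]} -> Prop) (u m : 'X_{1..n}).
Implicit Types (A : seq 'X_{1..n}) (r : 'X_{1..n} -> nat) (s : 'X_{1..n} -> {set 'I_n}).

Definition has_linear_quotients I A r s :=
  linear_quotients A r s /\ forall m, m \in A <-> mingens I m.

(** Some M in G(I^u) has colon x_l by m.  Away from x_l its exponents are at most
    those of m, hence too small for u; as u must meet M, it does so at x_l, where
    M has exponent m_l + 1. *)
Lemma shedding_exponent I u m l : shedding I u ->
  mingens (ideal_sub I u) m -> l \in msuppset u -> u l = (m l).+1.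
Proof.
move=> [_ shed] m_sub lu;
  have [m' /mingens_sup[_ nb'] /mcolon_U[e le]] := shed m l m_sub lu.
have [_ /bracket1P b] := (mingens_sub I u m).1 m_sub.
rewrite inE in lu; apply/eqP; apply: contraNT nb' => ne.
apply/bracket1P => i ui; have := b i ui; case: (eqVneq i l) => [->|/le]; last by lia.
by rewrite e; lia.
Qed.

Lemma shedding_linear_quotients I u A1 r1 s1 A2 r2 s2 :
  shedding I u ->
  has_linear_quotients (ideal_sup I u) A1 r1 s1 ->
  has_linear_quotients (ideal_sub I u) A2 r2 s2 ->
  exists r s, [/\ has_linear_quotients I (A1 ++ A2) r s,
    {in A1, forall m, #|s m| = #|s1 m|} &
    {in A2, forall m, #|s m| = #|s2 m| + #|msuppset u|}].
Proof.
move=> shed [[u1 an1 inj1 var1 lin1] G1] [[u2 an2 inj2 var2 lin2] G2].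
have b1 m : m \in A1 -> bracket1 u m = false.
  by move=> /G1/mingens_sup[_ /negbTE].
have b2 m : m \in A2 -> bracket1 u m by move=> /G2/mingens_sub[].
pose N := (\max_(m <- A1) r1 m).+1.
have ltN m : m \in A1 -> r1 m < N by move=> mA; rewrite ltnS leq_bigmax_seq.
(* N exceeds every rank in A1, so that A1 precedes A2 for r. *)
pose r m := if bracket1 u m then (N + r2 m)%N else r1 m.
pose s m := if bracket1 u m then s2 m :|: msuppset u else s1 m.
have G m : (m \in A1 ++ A2) <-> mingens I m.
  rewrite mem_cat; split=> [/orP[/G1/mingens_sup[]|/G2/mingens_sub[]]//|gm].
  apply/orP; case: (boolP (bracket1 u m)) => b.
    by right; apply/G2/mingens_sub.
  by left; apply/G1/mingens_sup.
exists r, s; split; last first.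
- move=> m mA; rewrite /s b2 // cardsU (_ : _ :&: _ = set0) ?cards0 ?subn0 //.
  apply/setP=> l; rewrite in_set0; apply/negP; rewrite inE => /andP[ls lu].
  have [m' [m'A _ /mcolon_U[e _]]] := var2 m l mA ls.
  have := shedding_exponent shed ((G2 m).1 mA) lu.
  by rewrite (shedding_exponent shed ((G2 m').1 m'A) lu) e; lia.
- by move=> m mA; rewrite /s b1.
split=> //; split.
- rewrite cat_uniq u1 u2 andbT; apply/hasPn => m /b2 b.
  by apply/negP => /b1; rewrite b.
- by move=> m m' /G gm /G gm'; apply: mingens_antichain gm gm'.
- move=> m m'; rewrite !mem_cat /r.
  move=> /orP[] mA /orP[] m'A; rewrite ?(b1 _ mA) ?(b2 _ mA) ?(b1 _ m'A) ?(b2 _ m'A).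
  + exact: inj1.
  + by have := ltN _ mA; lia.
  + by have := ltN _ m'A; lia.
  + by move=> /addnI; apply: inj2.
- move=> m l; rewrite mem_cat => /orP[] mA; rewrite /s /r ?(b1 _ mA) ?(b2 _ mA).
    move=> /(var1 m l mA)[m' [m'A lt e]]; exists m'.
    by rewrite mem_cat m'A (b1 _ m'A).
  rewrite inE => /orP[/(var2 m l mA)[m' [m'A lt e]]|lu].
    by exists m'; rewrite mem_cat m'A orbT (b2 _ m'A) ltn_add2l.
  have [m' /G1 m'A e] := shed.2 m l ((G2 m).1 mA) lu.
  by exists m'; rewrite mem_cat m'A (b1 _ m'A) ltn_addr // ltN.
move=> m m'; rewrite !mem_cat /r /s.
move=> /orP[] mA /orP[] m'A; rewrite ?(b1 _ mA) ?(b2 _ mA) ?(b1 _ m'A) ?(b2 _ m'A).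
- exact: lin1.
- by have := ltN _ mA; lia.
- move=> _; have [l lu le] : exists2 l, u l != 0%N & u l <= m' l.
    have /bracket1P nb := negbT (b1 _ m'A).
    apply: Classical_Prop.NNPP => H; apply: nb => l ul; rewrite ltnNge;
      apply/negP => le.
    by apply: H; exists l.
  exists l; first by rewrite !inE lu orbT.
  by move/bracket1P: (b2 _ mA) => /(_ l lu); lia.
by rewrite ltn_add2l => /(lin2 m m' mA m'A)[l ls lt]; exists l; rewrite // inE ls.
Qed.

Lemma kdecomposable_linear_quotients k I : kdecomposable k I ->
  monomial_ideal I /\
  exists A r s, A <> [::] /\ has_linear_quotients I A r s.
Proof.
elim=> {I} [I mI [m0 G]|I u mI shed _ _ [_ [A2 [r2 [s2 [_ lq2]]]]] _ [_ [A1 [r1 [s1 [A1n lq1]]]]]];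
  split=> //.
  exists [:: m0], (fun=> 0%N), (fun=> set0); split=> //; split.
    split=> //.
    - by move=> m m'; rewrite !inE => /eqP-> /eqP->.
    - by move=> m m'; rewrite !inE => /eqP-> /eqP->.
    - by move=> m l _; rewrite inE.
  by move=> m; rewrite G inE; split=> /eqP.
have [r [s [lq _ _]]] := shedding_linear_quotients shed lq1 lq2.
by exists (A1 ++ A2), r, s; split=> //; case: (A1) A1n.
Qed.

End Shedding.

(** * Homogeneous matrices *)

Section Homogeneous.
Context {K : fieldType} {n : nat}.
Local Open Scope ring_scope.
Local Notation R := {mpoly K[n]}.
Implicit Types (p q : R) (e f : int) (m : 'X_{1..n}).

Definition hcomp e p : R := \sum_(m <- msupp p | (mdeg m)%:Z == e) p@_m *: 'X_[m].

Lemma mcoeff_hcomp e p m : (hcomp e p)@_m = if (mdeg m)%:Z == e then p@_m else 0.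
Proof.
rewrite /hcomp raddf_sum /= (eq_bigr (fun m' => if m' == m then p@_m else 0));
  last first.
  by move=> m' _; rewrite mcoeffZ mcoeffX; case: eqP => [->|]; rewrite ?mulr1 ?mulr0.
rewrite -big_mkcondr /=; case: (boolP (m \in msupp p)) => mp; last first.
  by rewrite big1 ?(memN_msupp_eq0 mp) ?if_same.
rewrite (eq_bigl (fun m' => (m' == m) && ((mdeg m)%:Z == e))); last first.
  by move=> m'; case: (eqVneq m' m) => [->|]; rewrite ?andbT ?andbF.
case: ifP => _; last by rewrite big_pred0 // => m'; rewrite andbF.
under eq_bigl do rewrite andbT.
by rewrite -big_filter filter_pred1_uniq ?msupp_uniq // big_seq1.
Qed.

Lemma hcomp_is_additive e : {morph hcomp e : p q / p + q}.
Proof.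
move=> p q; apply/mpolyP=> m; rewrite mcoeffD !mcoeff_hcomp mcoeffD.
by case: ifP; rewrite ?addr0.
Qed.

Lemma hcomp0 e : hcomp e 0 = 0.
Proof. by apply/mpolyP=> m; rewrite mcoeff_hcomp mcoeff0 if_same. Qed.

Lemma hcomp_sum (J : Type) (l : seq J) (P : pred J) (F : J -> R) e :
  hcomp e (\sum_(j <- l | P j) F j) = \sum_(j <- l | P j) hcomp e (F j).
Proof. exact: (big_morph _ (hcomp_is_additive e) (hcomp0 e)). Qed.

Lemma msupp_hcomp e p m : m \in msupp (hcomp e p) -> (mdeg m)%:Z = e.
Proof. by rewrite mcoeff_msupp mcoeff_hcomp; case: ((mdeg m)%:Z =P e) => //;
  rewrite eqxx. Qed.

Lemma hcomp_id e p : (forall m, m \in msupp p -> (mdeg m)%:Z = e) -> hcomp e p = p.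
Proof.
move=> H; apply/mpolyP=> m; rewrite mcoeff_hcomp; case: (boolP (m \in msupp p)) => mp.
  by rewrite H ?eqxx.
by rewrite memN_msupp_eq0 ?if_same.
Qed.

Lemma hcomp_eq0 e p : (forall m, m \in msupp p -> (mdeg m)%:Z != e) -> hcomp e p = 0.
Proof.
move=> H; apply/mpolyP=> m; rewrite mcoeff_hcomp mcoeff0.
by case: (boolP (m \in msupp p)) => [/H/negbTE->//|/memN_msupp_eq0->]; rewrite if_same.
Qed.

Lemma hcompM e f p q : (forall m, m \in msupp q -> (mdeg m)%:Z = f) ->
  hcomp (e + f) (p * q) = hcomp e p * q.
Proof.
move=> qf; rewrite {1}[p]mpolyE big_distrl hcomp_sum /= /hcomp big_distrl /= [RHS]big_mkcond.
apply: eq_bigr => m _; rewrite -scalerAl.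
have sub m' : m' \in msupp (p@_m *: ('X_[m] * q)) -> (mdeg m')%:Z = (mdeg m)%:Z + f.
  move=> /msuppZ_le; rewrite mulrC mem_msuppMX => /andP[le /qf <-].
  by rewrite -{1}(submK le) mdegD PoszD addrC.
rewrite -/(hcomp _ _); case: eqP => [<-|ne]; first by rewrite hcomp_id // scalerAl.
by apply: hcomp_eq0 => m' /sub ->; apply/eqP=> /addIr.
Qed.

(** A is the matrix of a graded map of degree 0 between free modules whose
    generators have degrees s and t. *)
Definition hom_mx a b (s : 'I_a -> int) (t : 'I_b -> int) (A : 'M[R]_(a, b)) :=
  forall i j m, m \in msupp (A i j) -> s i = t j + (mdeg m)%:Z.

Definition hcomp_mx a b (s : 'I_a -> int) (t : 'I_b -> int) (A : 'M[R]_(a, b)) :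
  'M[R]_(a, b) := \matrix_(i, j) hcomp (s i - t j) (A i j).

Section Mx.
Context {a b : nat} (s : 'I_a -> int) (t : 'I_b -> int).

Lemma hcomp_mx_hom (A : 'M[R]_(a, b)) : hom_mx s t (hcomp_mx s t A).
Proof. by move=> i j m; rewrite mxE => /msupp_hcomp->; rewrite addrC subrK. Qed.

Lemma hcomp_mx_id (A : 'M[R]_(a, b)) : hom_mx s t A -> hcomp_mx s t A = A.
Proof.
move=> h; apply/matrixP=> i j; rewrite mxE hcomp_id // => m /h->.
by rewrite addrC addKr.
Qed.

Lemma hom_mxD (A B : 'M[R]_(a, b)) : hom_mx s t A -> hom_mx s t B -> hom_mx s t (A + B).
Proof.
by move=> hA hB i j m; rewrite mxE => /msuppD_le; rewrite mem_cat => /orP[/hA|/hB].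
Qed.

Lemma hom_mxN (A : 'M[R]_(a, b)) : hom_mx s t A -> hom_mx s t (- A).
Proof. by move=> hA i j m; rewrite mxE (perm_mem (msuppN _)) => /hA. Qed.

End Mx.

Section MxMul.
Context {a b c : nat} (s : 'I_a -> int) (t : 'I_b -> int) (u : 'I_c -> int).

Lemma hcomp_mxM (A : 'M[R]_(a, b)) (D : 'M[R]_(b, c)) : hom_mx t u D ->
  hcomp_mx s u (A *m D) = hcomp_mx s t A *m D.
Proof.
move=> h; apply/matrixP=> i j; rewrite !mxE hcomp_sum; apply: eq_bigr => k _.
rewrite mxE -(@hcompM _ (t k - u j)).
  by rewrite addrA subrK.
by move=> m /h->; rewrite addrC addKr.
Qed.

Lemma hom_mxM (A : 'M[R]_(a, b)) (D : 'M[R]_(b, c)) :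
  hom_mx s t A -> hom_mx t u D -> hom_mx s u (A *m D).
Proof.
move=> hA hD i j m; rewrite -(hcomp_mx_id hA) -(hcomp_mxM _ hD); exact: hcomp_mx_hom.
Qed.
End MxMul.
End Homogeneous.

(** * Comparison of graded resolutions *)

(** Chain maps and homotopies are built degree by degree, each step depending on
    the previous one. *)
Lemma dependent_choice (T : nat -> Type) (P : forall i, T i -> Prop)
    (Q : forall i, T i -> T i.+1 -> Prop) :
  (exists x, P 0 x) ->
  (forall i x, P i x -> exists y, P i.+1 y /\ Q i x y) ->
  exists f : forall i, T i, (forall i, P i (f i)) /\ forall i, Q i (f i) (f i.+1).
Proof.
move=> ex0 step.
have next i (x : {x | P i x}) : {y : {y | P i.+1 y} | Q i (sval x) (sval y)}.
  have := ClassicalEpsilon.constructive_indefinite_description _ (step i _ (svalP x)).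
  by move=> [y [Py Qy]]; exists (exist _ y Py).
pose x0 := ClassicalEpsilon.constructive_indefinite_description _ ex0.
pose g := nat_rect (fun i => {x | P i x}) x0 (fun i x => sval (next i x)).
exists (fun i => sval (g i)); split=> i; first exact: svalP.
exact: (svalP (next i (g i))).
Qed.

Section Resolutions.
Context {K : fieldType} {n : nat}.
Local Open Scope ring_scope.
Local Notation R := {mpoly K[n]}.
Implicit Types (I J : R -> Prop).

Section Augmented.
Context {I : R -> Prop} (F : gfree_resolution I).

(** The augmented complex, with the ring itself in position 0: shifting the
    resolution by one place lets the augmentation and the differentials be
    handled alike. *)
Definition arank i := if i is i'.+1 then frank F i' else 1%N.

Definition ashift i : 'I_(arank i) -> int :=
  match i with 0 => fun=> 0 | i'.+1 => fshift (g := F) (i := i') end.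

Definition adiff i : 'M[R]_(frank F i, arank i) :=
  match i with 0 => augm F | i'.+1 => fdiff F i' end.

Local Notation sh := (fshift (g := F)).

Lemma adiff_hom i : hom_mx (sh (i := i)) (@ashift i) (adiff i).
Proof.
case: i => [|i] a b m /=; last exact: fdiff_homog.
by rewrite [b]ord1 add0r; apply: augm_homog.
Qed.

Lemma fdiff_hom i : hom_mx (sh (i := i.+1)) (sh (i := i)) (fdiff F i).
Proof. exact: (adiff_hom (i := i.+1)). Qed.

Lemma adiff_exact i (v : 'rV_(frank F i)) :
  v *m adiff i = 0 <-> exists w : 'rV_(frank F i.+1), v = w *m fdiff F i.
Proof. by case: i v => [|i] v; [apply: augm_exact | apply: fdiff_exact]. Qed.

Lemma fdiff_adiff i : fdiff F i *m adiff i = 0.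
Proof.
apply/row_matrixP=> a; rewrite row_mul row0; apply/adiff_exact.
by exists (delta_mx 0 a); rewrite -rowE.
Qed.

Lemma lift_rows a b c (D : 'M[R]_(b, c)) (A : 'M[R]_(a, c)) :
  (forall i, exists w : 'rV_b, row i A = w *m D) -> exists B : 'M_(a, b), A = B *m D.
Proof.
move=> /functional_choice[f fP]; exists (\matrix_i f i).
by apply/row_matrixP=> i; rewrite fP row_mul rowK.
Qed.

(** Any lift can be replaced by its homogeneous part, as D is homogeneous. *)
Lemma lift_hom a b c (s : 'I_a -> int) (t : 'I_b -> int) (u : 'I_c -> int)
    (D : 'M[R]_(b, c)) (A : 'M[R]_(a, c)) :
  hom_mx t u D -> hom_mx s u A -> (forall i, exists w : 'rV_b, row i A = w *m D) ->
  exists B : 'M_(a, b), hom_mx s t B /\ B *m D = A.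
Proof.
move=> hD hA /lift_rows[B e]; exists (hcomp_mx s t B); split; first exact: hcomp_mx_hom.
by rewrite -(hcomp_mxM s _ hD) -e hcomp_mx_id.
Qed.

Lemma lift_cycles a (s : 'I_a -> int) i (A : 'M[R]_(a, frank F i)) :
  hom_mx s (sh (i := i)) A -> A *m adiff i = 0 ->
  exists B : 'M_(a, frank F i.+1), hom_mx s (sh (i := i.+1)) B /\ B *m fdiff F i = A.
Proof.
move=> hA A0; apply: (lift_hom (@fdiff_hom i) hA) => j.
by apply/adiff_exact; rewrite -row_mul A0 row0.
Qed.

Lemma lift_ideal a (s : 'I_a -> int) (A : 'cV[R]_a) :
  hom_mx s (fun=> 0) A -> (forall j, I (A j 0)) ->
  exists B : 'M_(a, frank F 0), hom_mx s (sh (i := 0)) B /\ B *m augm F = A.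
Proof.
move=> hA IA; apply: (lift_hom (@adiff_hom 0) hA) => j.
have /augm_image := IA j; move=> /(_ F)[v e]; exists v; rewrite e.
by apply/rowP=> k; rewrite !mxE !ord1 eqxx.
Qed.

End Augmented.

Lemma hom_mx_shift a b (s : 'I_a -> int) (t : 'I_b -> int) (A : 'M[R]_(a, b)) d :
  hom_mx s t A -> hom_mx (fun i => d + s i) (fun i => d + t i) A.
Proof. by move=> h i j m /h->; rewrite addrA. Qed.

(** Multiplication by a homogeneous x lifts to the resolutions, by the usual
    induction on exactness.  The invariant kept along the induction is that the
    matrix to be lifted next consists of cycles. *)
Theorem comparison I J (F : gfree_resolution J) (G : gfree_resolution I) (x : R) (d : int) :
  (forall m, m \in msupp x -> (mdeg m)%:Z = d) ->
  (forall p, J p -> I (p * x)) ->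
  exists f : forall i, 'M[R]_(frank F i, frank G i),
  [/\ forall i, hom_mx (fun a => d + fshift (g := F) (i := i) a) (fshift (g := G) (i := i)) (f i),
      f 0 *m augm G = augm F *m x%:M &
      forall i, f i.+1 *m fdiff G i = fdiff F i *m f i].
Proof.
move=> xd Jx.
pose sh i (a : 'I_(frank F i)) := d + fshift a.
pose P i (f : 'M[R]_(frank F i, frank G i)) :=
  [/\ hom_mx (sh i) (fshift (g := G) (i := i)) f, fdiff F i *m f *m adiff G i = 0 &
    match i return 'M[R]_(frank F i, frank G i) -> Prop with
    0 => fun f => f *m augm G = augm F *m x%:M | _ => fun=> True end f].
have [||f [Pf Qf]] := @dependent_choice _ P
  (fun i (f : 'M_(frank F i, frank G i)) (f' : 'M_(frank F i.+1, frank G i.+1)) =>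
     f' *m fdiff G i = fdiff F i *m f); last first.
- by exists f; split=> // [i|]; [case: (Pf i) | case: (Pf 0)].
- move=> i f [hf f0 _].
  have [|f' [hf' e]] := @lift_cycles _ G _ (sh i.+1) _ (fdiff F i *m f) _ f0.
    by apply: hom_mxM hf; apply: hom_mx_shift; apply: fdiff_hom.
  exists f'; split=> //; split=> //=.
  by rewrite -mulmxA e mulmxA (@fdiff_adiff _ F i.+1) mul0mx.
have [||f [hf e]] := @lift_ideal _ G _ (sh 0) (augm F *m x%:M).
- apply: (@hom_mxM _ _ _ _ _ _ (fun=> d + 0)).
    exact: hom_mx_shift (@adiff_hom _ F 0).
  by move=> a b m; rewrite !ord1 mxE eqxx mulr1n addrC => /xd->.
- move=> j; rewrite mul_mx_scalar mxE mulrC; apply/Jx/(augm_image F).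
  exists (delta_mx 0 j); rewrite -rowE; apply/rowP=> k.
  by rewrite !mxE !ord1 eqxx mulr1n.
exists f; split=> //; rewrite -mulmxA /= e mulmxA.
by rewrite (@fdiff_adiff _ F 0) mul0mx.
Qed.

(** A chain endomorphism that lifts the zero map is null-homotopic.  No term
    through the ideal appears in degree 0, since E 0 itself lifts through the
    first syzygies. *)
Theorem homotopy I (F : gfree_resolution I) (E : forall i, 'M[R]_(frank F i)) :
  (forall i, hom_mx (fshift (g := F) (i := i)) (fshift (g := F) (i := i)) (E i)) ->
  E 0 *m augm F = 0 -> (forall i, E i.+1 *m fdiff F i = fdiff F i *m E i) ->
  exists h : forall i, 'M[R]_(frank F i, frank F i.+1),
  [/\ forall i, hom_mx (fshift (g := F) (i := i)) (fshift (g := F) (i := i.+1)) (h i),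
      E 0 = h 0 *m fdiff F 0 &
      forall i, E i.+1 = fdiff F i *m h i + h i.+1 *m fdiff F i.+1].
Proof.
move=> hE E0 EC.
pose P i (h : 'M[R]_(frank F i, frank F i.+1)) :=
  [/\ hom_mx (fshift (g := F) (i := i)) (fshift (g := F) (i := i.+1)) h,
    fdiff F i *m h *m fdiff F i = fdiff F i *m E i &
    match i return 'M[R]_(frank F i, frank F i.+1) -> Prop with
    0 => fun h => E 0 = h *m fdiff F 0 | _ => fun=> True end h].
have [||h [Ph Qh]] := @dependent_choice _ P
  (fun i (h : 'M_(frank F i, frank F i.+1)) (h' : 'M_(frank F i.+1, frank F i.+2)) =>
     E i.+1 = fdiff F i *m h + h' *m fdiff F i.+1); last first.
- by exists h; split=> // [i|]; [case: (Ph i) | case: (Ph 0)].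
- move=> i h [hh e _].
  have [||h' [hh' e']] := @lift_cycles _ F _ (fshift (g := F) (i := i.+1)) i.+1 (E i.+1 - fdiff F i *m h).
  + by apply: hom_mxD => //; apply: hom_mxN; apply: hom_mxM hh; apply: fdiff_hom.
  + by rewrite mulmxBl /= e EC subrr.
  exists h'; split; last by rewrite e' addrC subrK.
  split=> //; rewrite -mulmxA e' mulmxBr mulmxA.
  by rewrite (@fdiff_adiff _ F i.+1) mul0mx subr0.
have [h [hh e]] := @lift_cycles _ F _ _ 0 (E 0) (hE 0) E0.
by exists h; split=> //; rewrite -mulmxA e.
Qed.

End Resolutions.
Arguments ashift {K n I} F {i} a.

(** * Independence of the Betti numbers from the resolution *)

Section Invariance.
Context {K : fieldType} {n : nat}.
Local Open Scope ring_scope.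
Local Notation R := {mpoly K[n]}.
Implicit Types (I J : R -> Prop).
Local Notation reduce := (map_mx (mcoeff 0%MM)).

(** Graded maps respect the decomposition by degrees after tensoring with K. *)
Lemma reduce_piece a b (s : 'I_a -> int) (t : 'I_b -> int) (A : 'M[R]_(a, b)) j :
  hom_mx s t A ->
  diag_mx (\row_i (s i == j)%:R) *m reduce A = reduce A *m diag_mx (\row_i (t i == j)%:R).
Proof.
move=> h; apply/matrixP=> x y; rewrite mul_diag_mx mul_mx_diag !mxE mulrC.
case: (boolP (0%MM \in msupp (A x y))) => [/h->|/memN_msupp_eq0->].
  by rewrite mdeg0 addr0.
by rewrite !mul0r.
Qed.

Lemma tensor_piece_idem I (F : gfree_resolution I) i j :
  tensor_piece F i j *m tensor_piece F i j = tensor_piece F i j.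
Proof.
rewrite /tensor_piece mulmx_diag; congr diag_mx; apply/rowP=> a; rewrite !mxE.
by case: eqP; rewrite ?mulr1 ?mulr0.
Qed.

Lemma tor_cycles_piece I (F : gfree_resolution I) i j :
  (tor_cycles F i j <= tensor_piece F i j)%MS.
Proof. by case: i => [|i] //=; rewrite capmxSl. Qed.

Lemma tor_boundaries_cycles I (F : gfree_resolution I) i j :
  (tor_boundaries F i j <= tor_cycles F i j)%MS.
Proof.
have le : (tor_boundaries F i j <= tensor_piece F i j)%MS.
  by rewrite /tor_boundaries (reduce_piece _ (@fdiff_hom _ _ _ F i)) submxMl.
case: i le => [|i] le //=; rewrite sub_capmx le; apply/sub_kermxP.
by rewrite /tor_boundaries -mulmxA -map_mxM (@fdiff_adiff _ _ _ F i.+1) raddf0 mulmx0.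
Qed.

(** Comparison maps f : F -> G and g : G -> F exist, and f g is homotopic to the
    identity.  After tensoring with K a cycle of F that f sends to a boundary is
    therefore a boundary, so that f embeds the homology of F into that of G. *)
Lemma tor_dim_le I (F G : gfree_resolution I) i j : (tor_dim F i j <= tor_dim G i j)%N.
Proof.
have one_hom m : m \in msupp (1 : R) -> (mdeg m)%:Z = 0.
  by rewrite msupp1 inE => /eqP->; rewrite mdeg0.
have [f [hf f0 fC]] : exists f : forall i, 'M[R]_(frank F i, frank G i),
    [/\ forall i, hom_mx (fshift (g := F) (i := i)) (fshift (g := G) (i := i)) (f i),
      f 0 *m augm G = augm F &
      forall i, f i.+1 *m fdiff G i = fdiff F i *m f i].
  have [|f [hf f0 fC]] := comparison F G one_hom; first by move=> p; rewrite mulr1.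
  exists f; split=> // [i' a b m /hf|]; first by rewrite add0r.
  by rewrite f0 mulmx1.
have [g [hg g0 gC]] : exists f : forall i, 'M[R]_(frank G i, frank F i),
    [/\ forall i, hom_mx (fshift (g := G) (i := i)) (fshift (g := F) (i := i)) (f i),
      f 0 *m augm F = augm G &
      forall i, f i.+1 *m fdiff F i = fdiff G i *m f i].
  have [|g [hg g0 gC]] := comparison G F one_hom; first by move=> p; rewrite mulr1.
  exists g; split=> // [i' a b m /hg|]; first by rewrite add0r.
  by rewrite g0 mulmx1.
have [|||h [hh h0 hS]] := homotopy (F := F) (E := fun i => f i *m g i - 1%:M).
- move=> k; apply: hom_mxD; first exact: hom_mxM (hf k) (hg k).
  apply: hom_mxN => a b m; rewrite mxE; case: eqP => [->|_];
    last by rewrite mulr0n msupp0.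
  by rewrite mulr1n => /one_hom->; rewrite addr0.
- by rewrite mulmxBl -mulmxA g0 f0 mul1mx subrr.
- move=> k; rewrite mulmxBl mulmxBr mul1mx mulmx1 -mulmxA gC mulmxA fC.
  by rewrite -mulmxA.
have ZZ' k : (tor_cycles F k j *m reduce (f k) <= tor_cycles G k j)%MS.
  have le : (tor_cycles F k j *m reduce (f k) <= tensor_piece G k j)%MS.
    apply: (submx_trans (submxMr _ (tor_cycles_piece F k j))).
    by rewrite (reduce_piece _ (hf k)) submxMl.
  case: k le => [|k] le //=; rewrite sub_capmx le; apply/sub_kermxP.
  rewrite -mulmxA -map_mxM fC map_mxM mulmxA.
  by rewrite (sub_kermxP (capmxSr _ _)) mul0mx.
have homotopic k p (X : 'M_(p, _)) : (X <= tor_cycles F k j)%MS ->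
    X *m reduce (f k) *m reduce (g k) = X + X *m reduce (h k) *m tensor_diff F k.
  move=> XZ; have fgE : f k *m g k = 1%:M + (f k *m g k - 1%:M) by rewrite addrC subrK.
  rewrite -mulmxA -map_mxM fgE map_mxD map_mx1 mulmxDr mulmx1.
  congr (_ + _); rewrite -mulmxA -map_mxM; case: k X {fgE} XZ => [|k] X XZ;
    first by rewrite h0.
  move: XZ; rewrite /= sub_capmx => /andP[_ /sub_kermxP X0].
  by rewrite hS raddfD /= mulmxDr map_mxM mulmxA X0 mul0mx add0r.
set Z := tor_cycles F i j; set Z' := tor_cycles G i j.
set B := tor_boundaries F i j; set B' := tor_boundaries G i j.
have B'B : (B' *m reduce (g i) <= B)%MS.
  rewrite /B' /B /tor_boundaries -mulmxA -map_mxM -gC map_mxM mulmxA.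
  by rewrite (reduce_piece _ (hg i.+1)) -mulmxA submxMl.
have null p (X : 'M_(p, _)) : (X <= Z)%MS -> (X *m reduce (f i) <= B')%MS -> (X <= B)%MS.
  move=> XZ XB'.
  have XP : X = X *m tensor_piece F i j.
    have /submxP[Y ->] := submx_trans XZ (tor_cycles_piece F i j).
    by rewrite -mulmxA tensor_piece_idem.
  have hB : (X *m reduce (h i) *m tensor_diff F i <= B)%MS.
    rewrite {1}XP -(mulmxA X) (reduce_piece _ (hh i)) mulmxA -mulmxA; exact: submxMl.
  have e := homotopic i _ X XZ.
  rewrite -[X](addrK (X *m reduce (h i) *m tensor_diff F i)) -e.
  rewrite addmx_sub ?eqmx_opp //; apply: submx_trans B'B; exact: submxMr.
have kerB' p (X : 'M_(p, _)) : (X *m cokermx B' == 0) = (X <= B')%MS by rewrite submxE.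
(* Rank count for Z -> Z' / B', whose kernel lies in B. *)
rewrite /tor_dim -/Z -/Z' -/B -/B'.
have := mxrank_mul_ker Z' (cokermx B');
  have := mxrank_mul_ker Z (reduce (f i) *m cokermx B').
set k := (\rank (Z :&: _)); set k' := (\rank (Z' :&: _)) => eZ eZ'.
have lek : (k <= \rank B)%N.
  apply: mxrankS; apply: null; first exact: capmxSl.
  by rewrite submxE -mulmxA; apply/eqP/sub_kermxP; apply: capmxSr.
have gek : (\rank B' <= k')%N.
  apply: mxrankS; rewrite sub_capmx tor_boundaries_cycles; apply/sub_kermxP/eqP.
  by rewrite kerB'.
have le : (\rank (Z *m (reduce (f i) *m cokermx B')) <= \rank (Z' *m cokermx B'))%N.
  by rewrite mulmxA; apply: mxrankS; apply: submxMr.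
have : (k' <= \rank B')%N.
  apply: mxrankS; rewrite submxE; apply/eqP/sub_kermxP; exact: capmxSr.
lia.
Qed.

Lemma tor_dim_unique I (F G : gfree_resolution I) i j : tor_dim F i j = tor_dim G i j.
Proof. by apply/eqP; rewrite eqn_leq !tor_dim_le. Qed.

Lemma bettiE I (F : gfree_resolution I) i j : betti I i j = tor_dim F i j.
Proof.
have [G e] := ClassicalEpsilon.epsilon_spec (inhabits 0%N)
  (fun b => exists F : gfree_resolution I, b = tor_dim F i j)
  (ex_intro _ _ (ex_intro _ F erefl)).
by rewrite /betti e; apply: tor_dim_unique.
Qed.

End Invariance.

(** * Mapping cones *)

Section MappingCone.
Context {K : fieldType} {n : nat}.
Local Open Scope ring_scope.
Local Notation R := {mpoly K[n]}.
Implicit Types (I J : R -> Prop).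
Local Notation reduce := (map_mx (mcoeff 0%MM)).

Definition minimal I (F : gfree_resolution I) := forall i, tensor_diff F i = 0.

Definition fcount I (F : gfree_resolution I) i (j : int) : nat :=
  \sum_(a < frank F i) (fshift a == j).

Definition acount I (F : gfree_resolution I) i (j : int) : nat :=
  \sum_(a < arank F i) (ashift F a == j).

Lemma hom_mx_row a1 a2 b (s : 'I_(a1 + a2) -> int) (t : 'I_b -> int)
    (A1 : 'M[R]_(a1, b)) (A2 : 'M[R]_(a2, b)) :
  hom_mx (s \o @lshift a1 a2) t A1 -> hom_mx (s \o @rshift a1 a2) t A2 ->
  hom_mx s t (col_mx A1 A2).
Proof.
move=> h1 h2 i j m; rewrite -[i]splitK; case: split => k /=.
  by rewrite col_mxEu => /h1.
by rewrite col_mxEd => /h2.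
Qed.

Lemma hom_mx_col a b1 b2 (s : 'I_a -> int) (t : 'I_(b1 + b2) -> int)
    (A1 : 'M[R]_(a, b1)) (A2 : 'M[R]_(a, b2)) :
  hom_mx s (t \o @lshift b1 b2) A1 -> hom_mx s (t \o @rshift b1 b2) A2 ->
  hom_mx s t (row_mx A1 A2).
Proof.
move=> h1 h2 i j m; rewrite -[j]splitK; case: split => k /=.
  by rewrite row_mxEl => /h1.
by rewrite row_mxEr => /h2.
Qed.

Lemma reduce_eq0 a b (s : 'I_a -> int) (t : 'I_b -> int) (A : 'M[R]_(a, b)) :
  hom_mx s t A -> (forall i j, s i <> t j) -> reduce A = 0.
Proof.
move=> hA ne; apply/matrixP=> i j; rewrite !mxE; apply: memN_msupp_eq0; apply/negP.
by move=> /hA; rewrite mdeg0 addr0; apply: ne.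
Qed.

(** From J = I : x^M one gets the exact sequence
    0 -> R/J(- deg M) -> R/I -> R/I' -> 0, and the cone of a lift f of
    multiplication by x^M to the resolutions resolves the cokernel.  The cone is
    minimal because J is resolved linearly: the generators of the source of f
    have degree deg M + i + 1 while those of its target have degree at most
    deg M + i, which leaves no room for a constant entry. *)
Theorem mapping_cone I J I' (M : 'X_{1..n}) (G : gfree_resolution I) (F : gfree_resolution J) :
  (forall p, I (p * 'X_[M]) <-> J p) ->
  (forall p, I' p <-> exists q c, I q /\ p = q + c * 'X_[M]) ->
  minimal G ->
  (forall i a, fshift (g := G) (i := i) a <= (mdeg M + i)%:Z) ->
  (forall i a, fshift (g := F) (i := i) a = i.+1) ->
  exists C : gfree_resolution I', minimal C /\
    forall i j, fcount C i j = (fcount G i j + acount F i (j - (mdeg M)%:Z))%N.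
Proof.
move=> colon adj minG shG shF.
have hX m : m \in msupp ('X_[M] : R) -> (mdeg m)%:Z = (mdeg M)%:Z.
  by rewrite msuppX inE => /eqP->.
have [|f [hf f0 fS]] := comparison F G hX; first by move=> p /colon.
pose rk i := (frank G i + arank F i)%N.
pose sh i (a : 'I_(rk i)) : int :=
  match split a with inl b => fshift b | inr b => (mdeg M)%:Z + ashift F b end.
pose au : 'cV[R]_(rk 0) := col_mx (augm G) 'X_[M]%:M.
pose di i : 'M[R]_(rk i.+1, rk i) := block_mx (fdiff G i) 0 (f i) (- adiff F i).
have shl i a : sh i (lshift _ a) = fshift a by rewrite /sh (unsplitK (inl a)).
have shr i a : sh i (rshift _ a) = (mdeg M)%:Z + ashift F a.
  by rewrite /sh (unsplitK (inr a)).
have au_hom a m : m \in msupp (au a 0) -> sh _ a = (mdeg m)%:Z.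
  have : hom_mx (@sh 0) (fun=> 0) au.
    apply: hom_mx_row => [i j m'|i j m'] /=.
      by rewrite shl [j]ord1 => /augm_homog->; rewrite add0r.
    by rewrite shr !ord1 mxE eqxx mulr1n => /hX->; rewrite addr0 add0r.
  by move=> h /h; rewrite add0r.
have di_hom i : hom_mx (@sh i.+1) (@sh i) (di i).
  apply: hom_mx_row; apply: hom_mx_col; move=> a b m /=.
  - by rewrite !shl => /fdiff_hom.
  - by rewrite mxE msupp0.
  - by rewrite shl shr => /hf.
  rewrite !shr => /(hom_mxN (@adiff_hom _ _ _ F i)) /= ->.
  by rewrite addrA.
have au_image p : I' p <-> exists v : 'rV_(rk 0), v *m au = p%:M.
  rewrite adj; split=> [[q [c [/(augm_image G)[v e] ->]]]|[v]].
    exists (row_mx v c%:M); rewrite mul_row_col e.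
    by rewrite -scalar_mxM raddfD.
  rewrite -[v]hsubmxK mul_row_col; set v1 := lsubmx v; rewrite [rsubmx v]mx11_scalar.
  set c := rsubmx v 0 0; rewrite -scalar_mxM [v1 *m _]mx11_scalar -raddfD.
  move=> /matrixP/(_ 0 0); rewrite !mxE !eqxx !mulr1n => <-.
  exists ((v1 *m augm G) 0 0), c; split; last by rewrite mxE.
  by apply/(augm_image G); exists v1; rewrite -mx11_scalar.
have au_exact (v : 'rV_(rk 0)) : v *m au = 0 <-> exists w : 'rV_(rk 1), v = w *m di 0%N.
  split=> [|[w ->]]; last first.
    rewrite -[w]hsubmxK mul_row_block mul_row_col mulmx0 add0r mulmxDl.
    rewrite -!mulmxA f0 (@fdiff_adiff _ _ _ G 0) mulmx0 add0r -mulmxDr mulNmx subrr.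
    by rewrite mulmx0.
  rewrite -[v]hsubmxK mul_row_col; set v1 := lsubmx v; rewrite [rsubmx v]mx11_scalar.
  set c := rsubmx v 0 0 => v0.
  have /colon/(augm_image F)[w ew] : I (c * 'X_[M]).
    apply/(augm_image G); exists (- v1); rewrite mulNmx scalar_mxM.
    by apply/eqP; rewrite eq_sym -addr_eq0 addrC v0.
  have /adiff_exact[v' ev'] : (v1 + w *m f 0%N) *m adiff G 0 = 0.
    by rewrite mulmxDl -mulmxA /= f0 mulmxA ew.
  exists (row_mx v' (- w)); rewrite mul_row_block mulmx0 add0r -ev' mulNmx addrK.
  by rewrite mulNmx mulmxN opprK /= ew.
have di_exact i (v : 'rV_(rk i.+1)) :
    v *m di i = 0 <-> exists w : 'rV_(rk i.+2), v = w *m di i.+1.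
  split=> [|[w ->]]; last first.
    rewrite -[w]hsubmxK mul_row_block mul_row_block !mulmx0 !add0r mulmxDl.
    rewrite -!mulmxA fS (@fdiff_adiff _ _ _ G i.+1) mulmx0 add0r -mulmxDr mulNmx subrr.
    by rewrite !mulNmx !mulmxN opprK fdiff_adiff !mulmx0 row_mx0.
  rewrite -[v]hsubmxK mul_row_block; set v1 := lsubmx v; set v2 := rsubmx v.
  rewrite mulmx0 add0r -row_mx0 => /eq_row_mx[e1].
  rewrite mulmxN => /eqP; rewrite oppr_eq0 => /eqP /adiff_exact[w ew].
  (* The second component lifts to w; correcting the first one by w f turns it
     into a cycle of G. *)
  have /adiff_exact[v' ev'] : (v1 + w *m f i.+1) *m adiff G i.+1 = 0.
    by rewrite mulmxDl -mulmxA /= fS mulmxA -ew.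
  exists (row_mx v' (- w)); rewrite mul_row_block mulmx0 add0r -ev' mulNmx addrK.
  by rewrite mulNmx mulmxN opprK /= ew.
pose C := GFreeResolution au_hom di_hom au_image au_exact di_exact.
exists C; split=> [i|i j]; last first.
  rewrite /fcount /acount /= big_split_ord /=; congr (_ + _)%N; apply: eq_bigr => a _.
    by rewrite shl.
  by rewrite shr; congr (nat_of_bool _); apply/eqP/eqP; lia.
rewrite /tensor_diff /= map_block_mx raddf0 raddfN /=.
rewrite -/(tensor_diff G i) minG (reduce_eq0 (hf i)); last first.
  by move=> a b; rewrite shF; have := shG i b; lia.
rewrite (reduce_eq0 (@adiff_hom _ _ _ F i)) ?oppr0 ?block_mx0 //.
by move=> a b; rewrite shF; case: (i) b => [|k] b; rewrite /= ?shF; lia.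
Qed.

End MappingCone.

(** * Betti numbers of ideals with linear quotients *)

Section BettiTable.
Context {K : fieldType} {n : nat}.
Local Open Scope ring_scope.
Local Notation R := {mpoly K[n]}.
Implicit Types (I J : R -> Prop).

Lemma rank_diag_mx k (d : 'rV[K]_k) : \rank (diag_mx d) = (\sum_(a < k) (d ord0 a != 0%R))%N.
Proof.
elim: k d => [|k IH] d; first by rewrite flatmx0 mxrank0 big_ord0.
suff H (d' : 'rV[K]_(1 + k)) : \rank (diag_mx d') = (\sum_(a < 1 + k) (d' ord0 a != 0%R))%N.
  exact: (H d).
rewrite -[d']hsubmxK diag_mx_row rank_diag_block_mx IH big_split_ord /=.
congr (_ + _)%N; last by apply: eq_bigr => a _; rewrite row_mxEr.
rewrite big_ord1 rank_rV row_mxEl; congr (nat_of_bool (~~ _)).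
apply/eqP/eqP => [/matrixP/(_ ord0 ord0)|e];
  first by rewrite mxE eqxx mulr1n mxE [X in _ = X]mxE.
by rewrite (_ : lsubmx d' = 0) ?raddf0 //; apply/rowP=> a; rewrite [a]ord1 e mxE.
Qed.

Lemma tor_dim_minimal I (F : gfree_resolution I) i j :
  minimal F -> tor_dim F i j = fcount F i j.
Proof.
move=> minF; rewrite /tor_dim /tor_boundaries minF mulmx0 mxrank0 subn0.
have -> : \rank (tor_cycles F i j) = \rank (tensor_piece F i j).
  case: i => [|i] //=; rewrite minF.
  by apply/eqP; rewrite mxrank_leqif_eq ?capmxSl // sub_capmx submx_refl kermx0 submx1.
rewrite rank_diag_mx; apply: eq_bigr => a _; rewrite mxE.
by case: (fshift a == j); rewrite ?oner_eq0 ?eqxx.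
Qed.

Lemma fcount_gt0 I (F : gfree_resolution I) i (a : 'I_(frank F i)) :
  (0 < fcount F i (fshift a))%N.
Proof. by rewrite /fcount (bigD1 a) //= eqxx. Qed.

Lemma mideal_eq (S T : 'X_{1..n} -> Prop) :
  (forall m, S m -> exists2 m', T m' & (m' <= m)%MM) ->
  (forall m, T m -> exists2 m', S m' & (m' <= m)%MM) ->
  forall p : R, mideal S p <-> mideal T p.
Proof.
move=> ST TS p; rewrite !midealP; split=> H m /H [m0].
  by move=> /ST[m' ? le'] le; exists m'; last exact: lepm_trans le.
by move=> /TS[m' ? le'] le; exists m'; last exact: lepm_trans le.
Qed.

Lemma resolution_zero_ideal I : (forall p, I p <-> p = 0) ->
  exists F : gfree_resolution I, minimal F /\ forall i j, fcount F i j = 0%N.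
Proof.
move=> I0; pose rk (i : nat) := 0%N.
pose au : 'cV[R]_(rk 0%N) := 0; pose di i : 'M[R]_(rk i.+1, rk i) := 0.
have au_hom (a : 'I_(rk 0%N)) m : m \in msupp (au a ord0) -> (0 : int) = (mdeg m)%:Z.
  by case: a.
have di_hom i (a : 'I_(rk i.+1)) (b : 'I_(rk i)) m :
  m \in msupp (di i a b) -> (0 : int) = 0 + (mdeg m)%:Z by case: a.
have au_image p : I p <-> exists v : 'rV_(rk 0%N), v *m au = p%:M.
  rewrite I0; split=> [->|[v]]; first by exists 0; rewrite mul0mx raddf0.
  by rewrite mulmx0 => /matrixP/(_ 0 0); rewrite !mxE eqxx mulr1n.
have au_exact (v : 'rV_(rk 0%N)) : v *m au = 0 <-> exists w : 'rV_(rk 1%N), v = w *m di 0%N.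
  by rewrite mulmx0; split=> // _; exists 0; apply/rowP; case.
have di_exact i (v : 'rV_(rk i.+1)) :
    v *m di i = 0 <-> exists w : 'rV_(rk i.+2), v = w *m di i.+1.
  by rewrite mulmx0; split=> // _; exists 0; apply/rowP; case.
pose F := @GFreeResolution _ _ _ rk (fun=> fun=> 0) _ _ au_hom di_hom au_image au_exact di_exact.
exists F; split=> [i|i j]; last by rewrite /fcount big_ord0.
by apply/matrixP; case.
Qed.

(** The Koszul complex, obtained by iterated cones: a variable outside s is a
    nonzerodivisor modulo the ideal generated by s. *)
Lemma resolution_variables (s : seq 'I_n) (J : R -> Prop) : uniq s ->
  (forall p, J p <-> mideal (fun m => exists2 l, l \in s & m = U_(l)%MM) p) ->
  exists F : gfree_resolution J, minimal F /\
    forall i j, fcount F i j = ((j == i.+1%:Z) * 'C(size s, i.+1))%N.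
Proof.
elim: s J => [|l s IH] J /= us defJ.
  have [|F [minF F0]] := @resolution_zero_ideal J.
    move=> p; rewrite defJ midealP; split=> [H|-> m]; last by rewrite msupp0.
    apply/eqP; rewrite -msupp_eq0; case E: (msupp p) => [//|m t].
    by have [|m0 [? //]] := H m; rewrite E mem_head.
  by exists F; split=> // i j; rewrite F0 bin0n muln0.
case/andP: us => ls us.
have [F [minF cF]] := IH _ us (fun p => iff_refl _).
have shF i a : fshift (g := F) (i := i) a = i.+1.
  by have := fcount_gt0 a; rewrite cF; case: eqP.
have [|||C [minC cC]] := @mapping_cone _ _ _ _ J U_(l) F F _ _ minF _ shF.
- move=> p; rewrite mideal_colon; apply: mideal_eq => m [].
    move=> m0 [k ks ->] ->; have kl : k != l by apply: contraNneq ls => <-.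
    exists U_(k)%MM; first by exists k.
    apply/mnm_lepP=> i; rewrite mcolonE !mnm1E.
    by case: (eqVneq k i) => // <-; rewrite eq_sym (negbTE kl).
  move=> k ks ->; exists (mcolon U_(k) U_(l))%MM; first by exists U_(k)%MM => //;
    exists k.
  by apply/mnm_lepP=> i; rewrite mcolonE; lia.
- move=> p; rewrite defJ -mideal_adjoin; apply: mideal_eq => m.
    move=> [k]; rewrite inE => /orP[/eqP-> ->|ks ->].
      by exists U_(l)%MM; [left | apply: lepm_refl].
    by exists U_(k)%MM; [right; exists k | apply: lepm_refl].
  move=> [->|[k ks ->]].
    by exists U_(l)%MM; [exists l; rewrite ?mem_head | apply: lepm_refl].
  by exists U_(k)%MM; [exists k; rewrite // inE ks orbT | apply: lepm_refl].
- by move=> i a; rewrite shF mdeg1.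
exists C; split=> // i j; rewrite cC cF mdeg1 binS mulnDr; congr (_ + _)%N.
case: i => [|i]; rewrite /acount /=.
  by rewrite big_ord1 bin0 muln1; congr nat_of_bool; apply/eqP/eqP; lia.
rewrite -/(fcount F i (j - 1)) cF; congr (nat_of_bool _ * _)%N.
by apply/eqP/eqP; lia.
Qed.

Lemma seq_argmax (T : eqType) (A : seq T) (r : T -> nat) : A <> [::] ->
  exists2 x, x \in A & {in A, forall y, (r y <= r x)%N}.
Proof.
elim: A => // x [|y A] IH _; first by exists x => [|z]; rewrite inE // => /eqP->.
have [//|z zA zmax] := IH; have [le|lt] := leqP (r x) (r z).
  by exists z => [|t]; rewrite inE ?zA ?orbT // => /orP[/eqP->|/zmax].
exists x => [|t]; rewrite ?mem_head // inE => /orP[/eqP->|/zmax] //.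
by move/leq_trans; apply; apply: ltnW.
Qed.

(** Induction on the number of generators: the one of largest rank is adjoined
    to the others by a mapping cone with the Koszul complex on its set of
    variables.  The degree hypothesis on r bounds the shifts of the resolution of
    the others as the minimality of the cone requires. *)
Lemma linear_quotients_resolution (A : seq 'X_{1..n}) r s I :
  linear_quotients A r s ->
  {in A &, forall m m', (r m' < r m)%N -> (mdeg m' <= mdeg m)%N} ->
  (forall p, I p <-> mideal (fun m => m \in A) p) ->
  exists F : gfree_resolution I, minimal F /\
    forall i j, fcount F i j = (\sum_(m <- A | j == (mdeg m + i)%:Z) 'C(#|s m|, i))%N.
Proof.
have [N] := ubnP (size A); elim: N A I => // N IH A I ltN lq degA defI.
have [A0|/eqP An] := eqVneq A [::].
  have [|F [minF F0]] := @resolution_zero_ideal I.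
    move=> p; rewrite defI A0 midealP; split=> [H|-> m]; last by rewrite msupp0.
    apply/eqP; rewrite -msupp_eq0; case E: (msupp p) => [//|m t].
    by have [|m0 //] := H m; rewrite E mem_head.
  by exists F; split=> // i j; rewrite F0 A0 big_nil.
have [m mA mmax] := seq_argmax r An.
case: lq => uA anti inj var lin.
pose A' := rem m A; have pA : perm_eq A (m :: A') by apply: perm_to_rem.
have A'E x : (x \in A') = (x != m) && (x \in A) by rewrite mem_rem_uniq // !inE.
have ltm x : x \in A' -> (r x < r m)%N.
  rewrite A'E => /andP[ne xA]; rewrite ltn_neqAle mmax // andbT.
  by apply: contraNneq ne => /inj->.
have subA x : x \in A' -> x \in A by rewrite A'E => /andP[].
have earlier x y : x \in A -> y \in A -> (r y < r x)%N -> y \in A'.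
  move=> xA yA lt; rewrite A'E yA andbT; apply: contraTneq lt => ->.
  by rewrite -leqNgt mmax.
have [|||G [minG cG]] := IH A' _ _ _ _ (fun p => iff_refl _).
- by move: ltN; rewrite (perm_size pA).
- split=> [|x y /subA ? /subA|x y /subA ? /subA|x l xA' lx|x y /subA ? /subA].
  + by rewrite rem_uniq.
  + exact: anti.
  + exact: inj.
  + have [y [yA lt e]] := var x l (subA _ xA') lx.
    by exists y; split=> //; apply: earlier lt => //; apply: subA.
  + exact: lin.
- by move=> x y /subA ? /subA; apply: degA.
have [F [minF cF]] := @resolution_variables (enum (s m)) _ (enum_uniq _) (fun p => iff_refl _).
have shF i a : fshift (g := F) (i := i) a = i.+1.
  by have := fcount_gt0 a; rewrite cF; case: eqP.
have shG i a : fshift (g := G) (i := i) a <= (mdeg m + i)%:Z.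
  have := fcount_gt0 a; rewrite cG; apply: contraTT; rewrite -ltNge => lt.
  rewrite -eqn0Ngt big_seq_cond big_pred0 // => x.
  apply/negP=> /andP[xA' /eqP e]; move: lt; rewrite e.
  by have := degA m x mA (subA _ xA') (ltm _ xA'); lia.
have [||C [minC cC]] := @mapping_cone _ _ _ _ I m G F _ _ minG shG shF.
- move=> p; rewrite mideal_colon; apply: mideal_eq => x.
    move=> [y yA' ->]; have [l ls lt] := lin m y mA (subA _ yA') (ltm _ yA').
    exists U_(l)%MM; first by exists l; rewrite ?mem_enum.
    by apply/mnm_lepP=> i; rewrite mcolonE mnm1E; case: eqP => // <-; lia.
  move=> [l]; rewrite mem_enum => /(var m l mA)[y [yA lt e]] ->.
  by exists U_(l)%MM; [exists y; first exact: earlier lt | apply: lepm_refl].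
- move=> p; rewrite defI -mideal_adjoin; apply: mideal_eq => x.
    rewrite (perm_mem pA) inE => h; exists x; last exact: lepm_refl.
    by case/orP: h => [/eqP|]; [left | right].
  move=> h; exists x; last exact: lepm_refl.
  by case: h => [->//|/subA].
exists C; split=> // i j; rewrite cC cG (perm_big _ pA) big_cons /= addnC.
case: i => [|i]; rewrite /acount /=.
  rewrite big_ord1 bin0 addn0 (_ : (0 == _) = (j == (mdeg m)%:Z));
    last by apply/eqP/eqP; lia.
  by case: ifP.
rewrite -/(fcount F i _) cF -cardE (_ : (_ == _) = (j == (mdeg m + i.+1)%:Z));
  last by apply/eqP/eqP; lia.
by case: ifP; rewrite ?mul1n ?mul0n.
Qed.

Theorem betti_linear_quotients (A : seq 'X_{1..n}) r s I i j :
  linear_quotients A r s -> (forall p, I p <-> mideal (fun m => m \in A) p) ->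
  betti I i j = (\sum_(m <- A | j == (mdeg m + i)%:Z) 'C(#|s m|, i))%N.
Proof.
move=> lq defI; have [r' lq' degA] := linear_quotients_sort lq.
have [F [minF cF]] := linear_quotients_resolution lq' degA defI.
by rewrite (bettiE F) tor_dim_minimal.
Qed.

End BettiTable.

(** * Projective dimension and regularity *)

Lemma greatestE {d} {T : orderType d} (x0 x : T) (S : T -> Prop) :
  S x -> (forall y, S y -> (y <= x)%O) -> greatest x0 S = x.
Proof.
move=> Sx maxx.
have [Sg maxg] := ClassicalEpsilon.epsilon_spec (inhabits x0)
  (fun x => S x /\ forall y, S y -> (y <= x)%O) (ex_intro _ x (conj Sx maxx)).
by apply/eqP; rewrite eq_le maxx //= maxg.
Qed.

Section LinearQuotientInvariants.
Context {K : fieldType} {n : nat}.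
Implicit Types (I : {mpoly K[n]} -> Prop) (A : seq 'X_{1..n}).
Implicit Types (r : 'X_{1..n} -> nat) (s : 'X_{1..n} -> {set 'I_n}).

Lemma betti_neq0 I A r s i j : monomial_ideal I -> has_linear_quotients I A r s ->
  betti I i j <> 0 <-> exists m, [/\ m \in A, j = (mdeg m + i)%:Z%R & i <= #|s m|].
Proof.
move=> mI [lq G].
have -> := betti_linear_quotients i j lq; last first.
  move=> p; rewrite (monomial_ideal_mingens mI).
  by apply: mideal_eq => m /G gm; exists m; rewrite ?lepm_refl.
split=> [/eqP|[m [mA jE le]]].
  rewrite sum_nat_seq_neq0 => /hasP[m mA /andP[/eqP e]].
  by rewrite -lt0n bin_gt0 => le; exists m.
apply/eqP; rewrite sum_nat_seq_neq0; apply/hasP; exists m => //.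
by rewrite jE eqxx -lt0n bin_gt0.
Qed.

Lemma pd_linear_quotients I A r s :
  monomial_ideal I -> has_linear_quotients I A r s -> A <> [::] ->
  pd I = \max_(m <- A) #|s m|.
Proof.
move=> mI lq /(seq_argmax (fun m => #|s m|))[m mA mmax]; apply: greatestE => [|i [j]].
  exists (mdeg m + \max_(m <- A) #|s m|)%:Z%R; apply/(betti_neq0 _ _ mI lq); exists m;
    split=> //.
  by apply/bigmax_leqP_seq => m' m'A _; apply: mmax.
move=> /(betti_neq0 _ _ mI lq)[m' [m'A _ le]].
by apply: (leq_trans le); rewrite leq_bigmax_seq.
Qed.

Lemma reg_linear_quotients I A r s :
  monomial_ideal I -> has_linear_quotients I A r s -> A <> [::] ->
  reg I = (\max_(m <- A) mdeg m)%:Z%R.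
Proof.
move=> mI lq /(seq_argmax (@mdeg n))[m mA mmax];
  apply: greatestE => [|_ [i [j [b ->]]]].
  have -> : \max_(m <- A) mdeg m = mdeg m.
    by apply/eqP; rewrite eqn_leq leq_bigmax_seq // andbT;
      apply/bigmax_leqP_seq => m' m'A _; apply: mmax.
  exists 0%N, (mdeg m)%:Z%R; split; last by rewrite subr0.
  by apply/(betti_neq0 _ _ mI lq); exists m; rewrite addn0.
have [m' [m'A -> _]] := (betti_neq0 i j mI lq).1 b.
have : mdeg m' <= \max_(m <- A) mdeg m by rewrite leq_bigmax_seq.
lia.
Qed.

Lemma bigmax_addr (T : eqType) (A : seq T) (f : T -> nat) k : A <> [::] ->
  \max_(x <- A) (f x + k) = (\max_(x <- A) f x + k)%N.
Proof.
move=> An; have [x xA xmax] := seq_argmax f An; apply/eqP; rewrite eqn_leq.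
apply/andP; split; first by apply/bigmax_leqP_seq => y yA _;
  rewrite leq_add2r leq_bigmax_seq.
apply: (@leq_trans (f x + k)%N); last exact: (leq_bigmax_seq (F := fun x => f x + k)%N).
by rewrite leq_add2r; apply/bigmax_leqP_seq => y yA _; apply: xmax.
Qed.

End LinearQuotientInvariants.

Theorem corollary2p5 (K : fieldType) (n k : nat)
    (I : {mpoly K[n]} -> Prop) (u : 'X_{1..n})
    (I_monomial : monomial_ideal I)
    (u_shedding : shedding I u)
    (u_supp : (#|msuppset u| <= k + 1)%N)
    (Isub_kdec : kdecomposable k (ideal_sub I u))
    (Isup_kdec : kdecomposable k (ideal_sup I u)) :
  pd I = maxn (pd (ideal_sup I u)) (pd (ideal_sub I u) + #|msuppset u|)%N /\
  reg I = Order.max (reg (ideal_sup I u)) (reg (ideal_sub I u)).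
Proof.
have [mono1 [A1 [r1 [s1 [A1n lq1]]]]] := kdecomposable_linear_quotients Isup_kdec.
have [mono2 [A2 [r2 [s2 [A2n lq2]]]]] := kdecomposable_linear_quotients Isub_kdec.
have [r [s [lq sE1 sE2]]] := shedding_linear_quotients u_shedding lq1 lq2.
have An : A1 ++ A2 <> [::] by case: (A1) A1n.
rewrite (pd_linear_quotients I_monomial lq An) (reg_linear_quotients I_monomial lq An).
rewrite (pd_linear_quotients mono1 lq1 A1n) (reg_linear_quotients mono1 lq1 A1n).
rewrite (pd_linear_quotients mono2 lq2 A2n) (reg_linear_quotients mono2 lq2 A2n).
rewrite !big_cat /=; split; last by lia.
rewrite -bigmax_addr //; congr maxn; rewrite [LHS]big_seq [RHS]big_seq;
  apply: eq_bigr => m.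
  exact: sE1.
exact: sE2.
Qed.
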